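(* Let $n \geq 1$ and let $G = SL(n+1,\mathbf{k})$ with $\operatorname{char}(\mathbf{k})\neq 2$. Then for every spherical conjugacy class $C$ in $SL(n+1,\mathbf{k})$, $$W_C = \{w \in S_{n+1} : w^2 = 1,\ l_2(w)\leq r(C)\}.$$
   Context: $\mathbf{k}$ is an algebraically closed field. $B$ is the subgroup of upper-triangular matrices in $SL(n+1,\mathbf{k})$ and $H$ the subgroup of diagonal matrices. The Weyl group $N_G(H)/H$ of $G = SL(n+1,\mathbf{k})$ is identified with the permutation group $S_{n+1}$ of $\{1,\dots,n+1\}$ (a representative $\dot w$ of $w$ is a monomial matrix whose nonzero entries are in positions $(w(i), i)$), and $BwB = B\dot{w}B$. For a conjugacy class $C$ in $G$, $W_C = \{w \in S_{n+1} : C\cap(BwB)\neq\emptyset\}$; $C$ is called spherical if the action of $B$ on $C$ by conjugation has a dense orbit. For $w \in S_{n+1}$, $l_2(w) = |\{i \in [1,n+1] : w(i)>i\}|$. For any $g\in C$, $r(C) = \min\{\operatorname{rank}(g-cI_{n+1}) : c\in\mathbf{k}\}$, where $I_{n+1}$ is the identity matrix. *)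

(* Defs.v *)
From HB Require Import structures.
From mathcomp Require Import all_boot all_order all_fingroup all_algebra.
From mathcomp Require Import boolp classical_sets.
From mathcomp Require mpoly.

Set Implicit Arguments.
Unset Strict Implicit.
Unset Printing Implicit Defensive.

Import GRing.Theory.
Local Open Scope classical_set_scope.
Local Open Scope ring_scope.

Definition SL (k : fieldType) (n : nat) : set 'M[k]_n.+1 :=
  [set g | \det g = 1].

(* [is_trig_mx] means lower triangular, hence the transpose. *)
Definition borel (k : fieldType) (n : nat) : set 'M[k]_n.+1 :=
  [set b | SL b /\ is_trig_mx b^T].

Definition conjm (k : fieldType) (n : nat) (h g : 'M[k]_n.+1) : 'M[k]_n.+1 :=
  h *m g *m invmx h.

Definition SL_class (k : fieldType) (n : nat) (C : set 'M[k]_n.+1) : Prop :=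
  exists2 g, SL g & C = [set conjm h g | h in @SL k n].

(* A matrix is the point of affine space whose coordinates are its entries. *)
Definition zariski_closed (k : fieldType) (n : nat) (Z : set 'M[k]_n.+1) : Prop :=
  exists S : set (mpoly.mpoly (n.+1 * n.+1) k),
    Z = [set A | forall p, S p -> mpoly.meval (mxvec A 0) p = 0].

Definition zariski_closure (k : fieldType) (n : nat) (X : set 'M[k]_n.+1) :
    set 'M[k]_n.+1 :=
  \bigcap_(Z in [set Z | zariski_closed Z /\ X `<=` Z]) Z.

(* Density of the orbit for the subspace topology of [C]. *)
Definition spherical (k : fieldType) (n : nat) (C : set 'M[k]_n.+1) : Prop :=
  exists2 x, C x & C `<=` zariski_closure [set conjm b x | b in @borel k n].

(* [M] is a monomial matrix in SL with nonzero entries at the places (w j, j). *)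
Definition weyl_rep (k : fieldType) (n : nat) (w : 'S_n.+1) (M : 'M[k]_n.+1) : Prop :=
  SL M /\ forall i j, (M i j != 0) = (i == w j).

(* The double coset does not depend on the representative of [w], since two of
   them differ by a diagonal matrix, so all of them are allowed. *)
Definition bruhat_cell (k : fieldType) (n : nat) (w : 'S_n.+1) : set 'M[k]_n.+1 :=
  [set g | exists b1 M b2,
     [/\ borel b1, weyl_rep w M, borel b2 & g = b1 *m M *m b2]].

Definition W_ (k : fieldType) (n : nat) (C : set 'M[k]_n.+1) : set 'S_n.+1 :=
  [set w | C `&` @bruhat_cell k n w !=set0].

(* Ordinals start at 0 instead of 1, which does not affect comparisons. *)
Definition l2 (n : nat) (w : 'S_n.+1) : nat := #|[pred i : 'I_n.+1 | (i < w i)%N]|.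

Definition scalar_rank (k : fieldType) (n : nat) (g : 'M[k]_n.+1) (m : nat) : bool :=
  `[< exists c : k, \rank (g - c%:M)%R = m >].

Lemma scalar_rank_ex (k : fieldType) (n : nat) (g : 'M[k]_n.+1) :
  exists m, scalar_rank g m.
Proof. by exists (\rank (g - 0%:M)%R); apply/asboolP; exists 0. Qed.

Definition min_rank (k : fieldType) (n : nat) (g : 'M[k]_n.+1) : nat :=
  ex_minn (scalar_rank_ex g).

(* Main.v *)
Require Import Defs.
From mathcomp Require Import all_boot all_order all_fingroup all_algebra.
From mathcomp Require Import boolp classical_sets.
From mathcomp Require Import ring.
From mathcomp Require mpoly.

(** Write N = n + 1.  Everything rests on the fact that the elements g of a
    spherical class are quadratic: g^2 = s g - d with d <> 0.

    Why spherical implies quadratic.  The last coordinate row vector and the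
    first coordinate column vector are eigenvectors of every upper triangular
    matrix, so the two functions A |-> A_{N,1} and A |-> (A^2)_{N,1} are
    multiplied by the same factor when A is conjugated by an element of B.
    Their ratio is therefore constant on a dense B-orbit, hence on C: some
    combination Y = u g^2 + v g, with (u, v) <> 0, has zero corner in all
    conjugates of g ([spherical_corner_vanish]).  A matrix all of whose
    conjugates have zero corner is scalar ([corner_scalar]), so either g is
    itself scalar or Y = c is a quadratic equation for g
    ([spherical_quadratic]).

    Why W_C is contained in the right-hand side.  If C meets BwB, then it
    contains some g = b M with b in B and M representing w.  The inverse
    M^-1 b^-1 of g is a multiple of s - g, so off the diagonal g and g^-1 have
    the same support; comparing supports gives w (w y) <= y for all y, whence
    w^2 = 1 ([quadratic_borel_involution]).  For an involution, the minor of
    g - c with columns E = {i : i < w i} and rows w(E) does not see c, and it is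
    triangular with nonzero diagonal, so rank (g - c) >= l_2(w) ([l2_le_rank]).

    Why the right-hand side is contained in W_C.  The minimal rank r is reached
    at a root a of X^2 - s X + d ([min_rank_eigen]); let b = s - a be the other
    root.  Then X = g - a satisfies X^2 = (b - a) X, and such an X is determined
    up to conjugacy by its rank ([quadratic_conj]).  Moreover 2 r <= N.  Hence
    an involution w with l_2(w) <= r extends to one with exactly r
    transpositions ([involution_extend]).  Placing on each transposition of w
    the 2 x 2 block [0, -ab; 1, a + b], on each of the other transpositions the
    block [a, 1; 0, b], and a on the fixed points, gives a matrix that lies in
    BwB and is conjugate to g ([involution_model]). *)

Set Implicit Arguments.
Unset Strict Implicit.
Unset Printing Implicit Defensive.

Import GRing.Theory.
Local Open Scope classical_set_scope.
Local Open Scope ring_scope.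

(** * Conjugation and the Borel subgroup *)

Lemma conjmE (k : fieldType) n (h A B : 'M[k]_n.+1) :
  h \in unitmx -> h *m A = B *m h -> conjm h A = B.
Proof. by move=> uh E; rewrite /conjm E -mulmxA mulmxV // mulmx1. Qed.

Lemma conjm_scalar (k : fieldType) n (h : 'M[k]_n.+1) c :
  h \in unitmx -> conjm h c%:M = c%:M.
Proof. by move=> uh; apply: conjmE => //; rewrite scalar_mxC. Qed.

Lemma conjmB (k : fieldType) n (h A B : 'M[k]_n.+1) :
  conjm h (A - B) = conjm h A - conjm h B.
Proof. by rewrite /conjm mulmxBr mulmxBl. Qed.

Lemma conjmD (k : fieldType) n (h A B : 'M[k]_n.+1) :
  conjm h (A + B) = conjm h A + conjm h B.
Proof. by rewrite /conjm mulmxDr mulmxDl. Qed.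

Lemma conjmZ (k : fieldType) n c (h A : 'M[k]_n.+1) :
  conjm h (c *: A) = c *: conjm h A.
Proof. by rewrite /conjm -scalemxAr -scalemxAl. Qed.

Lemma conjmM (k : fieldType) n (h A B : 'M[k]_n.+1) :
  h \in unitmx -> conjm h (A *m B) = conjm h A *m conjm h B.
Proof. by move=> uh; rewrite /conjm -!mulmxA mulKmx. Qed.

Lemma conjm_comp (k : fieldType) n (h1 h2 A : 'M[k]_n.+1) :
  h1 \in unitmx -> h2 \in unitmx -> conjm h1 (conjm h2 A) = conjm (h1 *m h2) A.
Proof.
move=> u1 u2; symmetry; apply: conjmE; first by rewrite unitmx_mul u1.
by rewrite /conjm !mulmxA mulmxKV // mulmxKV.
Qed.

Lemma mxrank_conjm (k : fieldType) n (h A : 'M[k]_n.+1) :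
  h \in unitmx -> \rank (conjm h A) = \rank A.
Proof.
move=> uh; rewrite /conjm mxrankMfree ?row_free_unit ?unitmx_inv //.
by rewrite eqmxMfull // row_full_unit.
Qed.

Lemma SL_unitmx (k : fieldType) n (h : 'M[k]_n.+1) : SL h -> h \in unitmx.
Proof. by rewrite /SL /= unitmxE => ->; rewrite unitr1. Qed.

(** Over an algebraically closed field every invertible matrix is a scalar
    multiple of one of determinant 1, and scalars act trivially by conjugation. *)
Lemma SL_class_conj_GL (k : closedFieldType) n (C : set 'M[k]_n.+1) g h :
  SL_class C -> C g -> h \in unitmx -> C (conjm h g).
Proof.
move=> [g0 Sg0 ->] [h0 Sh0 <-] uh.
have [c cN] := @GRing.solve_monicpoly k n.+1
  (fun i => if i == 0%N then (\det h)^-1 else 0) isT.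
move: cN; rewrite big_ord_recl /= mulr1 big1 ?addr0 => [cN|i _]; last by rewrite mul0r.
have dh : \det h != 0 by rewrite -unitfE -unitmxE.
have c0 : c != 0 by apply: contra_eq_neq cN => ->; rewrite expr0n /= eq_sym invr_eq0.
exists ((c *: h) *m h0).
  by rewrite /SL /= det_mulmx Sh0 mulr1 detZ cN mulVf.
have uh0 := SL_unitmx Sh0.
rewrite -conjm_comp ?unitmxZ ?unitfE //.
apply: conjmE; rewrite ?unitmxZ ?unitfE // -scalemxAr -scalemxAl /conjm.
by rewrite -(mulmxA (h *m _)) mulVmx // mulmx1.
Qed.

Lemma SL_class_orbit (k : fieldType) n (C : set 'M[k]_n.+1) g g' :
  SL_class C -> C g -> C g' -> exists2 h, SL h & g' = conjm h g.
Proof.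
move=> [g0 Sg0 ->] [h Sh <-] [h' Sh' <-]; exists (h' *m invmx h).
  by rewrite /SL /= det_mulmx det_inv Sh Sh' invr1 mulr1.
have [uh uh'] := (SL_unitmx Sh, SL_unitmx Sh').
by rewrite conjm_comp ?unitmx_mul ?unitmx_inv ?uh ?uh' // -mulmxA mulVmx // mulmx1.
Qed.

Lemma SL_class_SL (k : fieldType) n (C : set 'M[k]_n.+1) g :
  SL_class C -> C g -> SL g.
Proof.
move=> [g0 Sg0 ->] [h Sh <-].
by rewrite /SL /= /conjm !det_mulmx det_inv Sh Sg0 invr1 !mulr1.
Qed.

Lemma borelP (k : fieldType) n (b : 'M[k]_n.+1) : borel b ->
  (forall i j : 'I_n.+1, (j < i)%N -> b i j = 0) /\ (forall i, b i i != 0).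
Proof.
move=> [Sb tb]; split=> [i j lt_ji|i].
  by have /is_trig_mxP/(_ j i lt_ji) := tb; rewrite mxE.
move: Sb; rewrite /SL /= -det_tr det_trig // => /eqP.
by apply: contraTN => /eqP bi0; rewrite (bigD1 i) //= mxE bi0 mul0r eq_sym oner_eq0.
Qed.

Lemma borelM (k : fieldType) n (b1 b2 : 'M[k]_n.+1) :
  borel b1 -> borel b2 -> borel (b1 *m b2).
Proof.
move=> B1 B2; have [t1 _] := borelP B1; have [t2 _] := borelP B2.
case: B1 B2 => [S1 _] [S2 _]; split.
  by rewrite /SL /= det_mulmx S1 S2 mulr1.
apply/is_trig_mxP => j i lt_ji; rewrite !mxE big1 // => l _.
have [lt_li|le_il] := ltnP l i; first by rewrite t1 ?mul0r.
by rewrite t2 ?mulr0 // (leq_trans lt_ji).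
Qed.

(** If column j of the inverse had a nonzero entry below the diagonal, the
    lowest one would give a nonzero entry of [b *m invmx b] off the diagonal. *)
Lemma invmx_borel (k : fieldType) n (b : 'M[k]_n.+1) (i j : 'I_n.+1) :
  borel b -> (j < i)%N -> invmx b i j = 0.
Proof.
move=> Bb; have [tb db] := borelP Bb; have ub : b \in unitmx by case: Bb => /SL_unitmx.
move=> lt_ji; apply/eqP/negPn/negP => bij.
case: (@arg_maxnP _ i (fun l => invmx b l j != 0) val bij) => l blj max_l.
have lt_jl : (j < l)%N by apply: leq_trans (max_l i bij).
have /matrixP/(_ l j) := mulmxV ub; rewrite mxE (bigD1 l) //= big1 ?addr0.
  by move/eqP; rewrite mxE -val_eqE gtn_eqF // mulf_eq0 (negPf blj) (negPf (db l)).
move=> x neq_xl; have [lt_xl|] := ltnP x l; first by rewrite tb ?mul0r.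
rewrite leq_eqVlt val_eqE eq_sym (negPf neq_xl) /= => lt_lx.
have [->|/max_l] := eqVneq (invmx b x j) 0; first by rewrite mulr0.
by rewrite /= leqNgt lt_lx.
Qed.

(** The corner A_{N,1} is a semi-invariant of B, of weight b_{NN} / b_{11}. *)
Lemma corner_borel (k : fieldType) n (b A : 'M[k]_n.+1) : borel b ->
  conjm b A ord_max 0 * b 0 0 = b ord_max ord_max * A ord_max 0.
Proof.
move=> Bb; have [tb _] := borelP Bb; case: Bb => /SL_unitmx ub _.
have /matrixP/(_ ord_max 0) : conjm b A *m b = b *m A.
  by rewrite /conjm -mulmxA mulVmx // mulmx1.
rewrite mxE [RHS]mxE (bigD1 0) //= big1 ?addr0 => [->|j j0]; last first.
  by rewrite tb ?mulr0 // lt0n.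
rewrite (bigD1 ord_max) //= big1 ?addr0 // => j jm.
rewrite tb ?mul0r //; rewrite ltn_neqAle -ltnS ltn_ord andbT.
by apply: contra_neq jm => /val_inj.
Qed.

(** Conjugation by permutation matrices moves every off-diagonal entry to the
    corner, so Y is diagonal in every basis; conjugation by a transvection then
    turns the difference of two diagonal entries into an off-diagonal entry. *)
Lemma corner_scalar (k : fieldType) n (Y : 'M[k]_n.+1) : (0 < n)%N ->
  (forall h, h \in unitmx -> conjm h Y ord_max 0 = 0) -> exists c, Y = c%:M.
Proof.
move=> n_gt0 Y0.
have mx0 : (ord_max : 'I_n.+1) != 0 by rewrite -val_eqE /= -lt0n.
have off (Z : 'M[k]_n.+1) : (forall h, h \in unitmx -> conjm h Z ord_max 0 = 0) ->
    forall i j : 'I_n.+1, i != j -> Z i j = 0.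
  move=> Z0 i j neq_ij; set t := tperm ord_max i.
  pose s : 'S_n.+1 := (t * tperm (t 0) j)%g.
  have s0 : s 0 = j by rewrite permM tpermL.
  have sm : s ord_max = i.
    rewrite permM [t ord_max]tpermL tpermD //; last by rewrite eq_sym.
    by rewrite -[X in _ != X](tpermL ord_max i) (inj_eq perm_inj) eq_sym.
  have := Z0 (perm_mx s) (unitmx_perm _ _).
  have -> : conjm (perm_mx s) Z = col_perm s (row_perm s Z).
    apply: conjmE; rewrite ?unitmx_perm // -row_permE [col_perm _ _]col_permE.
    by rewrite -mulmxA -perm_mxM mulVg perm_mx1 mulmx1.
  by rewrite !mxE s0 sm.
have offY := off _ Y0.
(* the (0, i) entry of (1 + d) Y (1 - d) compares Y_{ii} with Y_{00} *)
exists (Y 0 0); apply/matrixP => i j; rewrite mxE.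
have [<-|neq_ij] := eqVneq i j; last by rewrite offY.
have [->//|neq_i0] := eqVneq i 0; rewrite mulr1n.
pose d := delta_mx 0 i : 'M[k]_n.+1.
have dd : d *m d = 0 by rewrite mul_delta_mx_cond (negPf neq_i0).
have dVd : (1%:M - d) *m (1%:M + d) = 1%:M.
  by rewrite mulmxBl !mulmxDr !mul1mx mulmx1 dd addr0 addrK.
have [_ uh] := mulmx1_unit dVd.
have offZ : forall h, h \in unitmx -> conjm h (conjm (1%:M + d) Y) ord_max 0 = 0.
  by move=> h u; rewrite conjm_comp // Y0 // unitmx_mul u.
have {offZ} := off _ offZ 0 i; rewrite eq_sym => /(_ neq_i0).
have -> : conjm (1%:M + d) Y = (1%:M + d) *m Y *m (1%:M - d).
  apply: conjmE => //; rewrite -!mulmxA dVd mulmx1 //.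
have dE (Z : 'M[k]_n.+1) : (d *m Z) 0 i = Z i i.
  rewrite mxE (bigD1 i) //= big1 ?addr0 => [|l li]; rewrite mxE eqxx /=.
    by rewrite eqxx mul1r.
  by rewrite (negPf li) mul0r.
have Ed (Z : 'M[k]_n.+1) : (Z *m d) 0 i = Z 0 0.
  rewrite mxE (bigD1 0) //= big1 ?addr0 => [|l li]; rewrite mxE eqxx /=.
    by rewrite mulr1.
  by rewrite (negPf li) mulr0.
rewrite mulmxDl mul1mx mulmxBr mulmx1 mulmxDl mxE [X in X + _]mxE dE.
rewrite mxE [X in _ - X]mxE Ed Ed.
have -> : (d *m Y) 0 0 = 0.
  rewrite mxE big1 // => l _; rewrite mxE eqxx /=.
  by have [->|] := eqVneq l i; rewrite ?mul0r // mul1r offY.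
rewrite (offY 0 i) 1?eq_sym // add0r addr0 => /eqP; rewrite subr_eq0 => /eqP //.
Qed.

(** * Spherical classes are quadratic *)

Lemma corner_poly (k : fieldType) n (u v : k) :
  exists p : mpoly.mpoly (n.+1 * n.+1) k, forall A : 'M[k]_n.+1,
    mpoly.meval (mxvec A 0) p = u * (A *m A) ord_max 0 + v * A ord_max 0.
Proof.
pose P : comNzRingType :=
  mpoly.mpoly_mpoly__canonical__GRing_ComNzRing (n.+1 * n.+1) k.
pose X i j : P := mpoly.mpolyX k (mpoly.mnm1 (mxvec_index i j)).
pose K c : P := mpoly.mpolyC _ c.
have XE (A : 'M[k]_n.+1) i j : mpoly.meval (mxvec A 0) (X i j) = A i j.
  by rewrite mpoly.mevalXU mxvecE.
exists (K u * (\sum_j X ord_max j * X j 0) + K v * X ord_max 0) => A.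
rewrite mpoly.mevalD !mpoly.mevalM !mpoly.mevalC XE mxE; congr (u * _ + _).
rewrite (big_morph _ (mpoly.mevalD _) (mpoly.meval0 _)).
by apply: eq_bigr => j _; rewrite mpoly.mevalM !XE.
Qed.

(** A combination of A_{N,1} and (A^2)_{N,1} is again a semi-invariant, because
    squaring commutes with conjugation.  If it vanishes at x it vanishes on the
    B-orbit of x, hence on the closure of that orbit. *)
Lemma spherical_corner_vanish (k : fieldType) n (C : set 'M[k]_n.+1) x u v :
  C `<=` zariski_closure [set conjm b x | b in @borel k n] ->
  u * (x *m x) ord_max 0 + v * x ord_max 0 = 0 ->
  forall A, C A -> u * (A *m A) ord_max 0 + v * A ord_max 0 = 0.
Proof.
move=> dense x0 A CA; have [p pE] := corner_poly n u v.
rewrite -pE; apply: (dense A CA [set A | forall q, [set p] q ->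
  mpoly.meval (mxvec A 0) q = 0]) => //; split; first by exists [set p].
move=> _ [b Bb <-] _ ->; rewrite pE.
have [_ /(_ 0) b00] := borelP Bb.
have ub : b \in unitmx by case: Bb => /SL_unitmx.
apply: (mulIf b00); rewrite mul0r mulrDl -!mulrA -conjmM // !corner_borel //.
by rewrite ![_ * (b _ _ * _)]mulrCA -mulrDr x0 mulr0.
Qed.

(** The combination of the two corners is chosen to vanish at a point x of the
    dense orbit.  For invertible g, d = 0 would force g to be the scalar s, and a
    scalar c satisfies the equation with s = 2 c and d = c^2. *)
Lemma spherical_quadratic (k : closedFieldType) n (C : set 'M[k]_n.+1) g :
  (0 < n)%N -> SL_class C -> spherical C -> C g ->
  exists s d, d != 0 /\ g *m g = s *: g - d%:M.
Proof.
move=> n_gt0 hC [x Cx dense] Cg.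
have ug := SL_unitmx (SL_class_SL hC Cg).
have quad u v : u * (x *m x) ord_max 0 + v * x ord_max 0 = 0 ->
    exists c, u *: (g *m g) + v *: g = c%:M.
  move=> /(spherical_corner_vanish dense) C0; apply: corner_scalar => // h uh.
  rewrite conjmD !conjmZ conjmM // -[RHS](C0 _ (SL_class_conj_GL hC Cg uh)).
  by rewrite !mxE.
have scal c : g = c%:M -> exists s d, d != 0 /\ g *m g = s *: g - d%:M.
  move=> gc; exists (c + c), (c * c).
  have c0 : c != 0.
    by apply: contraTneq ug => c0; rewrite gc c0 unitmxE det_scalar expr0n unitr0.
  rewrite mulf_neq0 //; split=> //.
  by rewrite gc -scalar_mxM scale_scalar_mx -raddfB /= mulrDl addrK.
have [x0|x0] := eqVneq (x ord_max 0) 0.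
  have [|c] := quad 0 1; first by rewrite x0 mulr0 mul0r addr0.
  by rewrite scale0r add0r scale1r; apply: scal.
have [|c] := quad (x ord_max 0) (- (x *m x) ord_max 0).
  by rewrite mulNr mulrC subrr.
set y := (x *m x) _ _ => E; set z := x ord_max 0 in x0 E.
have gg : g *m g = (y / z) *: g - (- c / z)%:M.
  apply: (scalerI x0); rewrite scalerBr scalerA mulrCA divff // mulr1.
  rewrite scale_scalar_mx mulrCA divff // mulr1 raddfN /= opprK -E.
  by rewrite scaleNr addrC addrNK.
have [d0|] := eqVneq (- c / z) 0; last by exists (y / z), (- c / z).
apply: (scal (y / z)); move: gg; rewrite d0 raddf0 subr0 => gg.
by rewrite -[LHS](mulKmx ug) gg -scalemxAr mulVmx // scalemx1.
Qed.

(** * Conjugacy of the solutions of X^2 = e X *)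

(** Gaussian elimination gives X = L D R with D the partial identity; conjugating
    by L turns X into D (R L), whose lower rows vanish.  For such a matrix the
    equation says that the upper left block is the scalar e. *)
Lemma quadratic_block_form (F : fieldType) r m (X : 'M[F]_(r + m)) (e : F) :
  \rank X = r -> X *m X = e *: X ->
  exists h (B : 'M_(r, m)), h \in unitmx /\ h *m X = block_mx e%:M B 0 0 *m h.
Proof.
move=> rkX XX; set L := col_ebase X; set R := row_ebase X.
have uL : L \in unitmx by exact: col_ebase_unit.
have uR : R \in unitmx by exact: row_ebase_unit.
pose D : 'M[F]_(r + m) := block_mx 1%:M 0 0 0.
have XE : X = L *m D *m R.
  rewrite -{1}(mulmx_ebase X) rkX; congr (_ *m _ *m _).
  exact: pid_mx_block.
pose T := R *m L; have uT : T \in unitmx by rewrite unitmx_mul uR.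
have DTDT : D *m T *m D = e *: D.
  apply: (can_inj (mulKmx uL)); apply: (can_inj (mulmxK uR)).
  by rewrite -scalemxAr -scalemxAl !mulmxA -XE -XX XE /T !mulmxA.
have DT0 : D *m T = block_mx (ulsubmx T) (ursubmx T) 0 0.
  by rewrite -{1}(submxK T) mulmx_block !(mul1mx, mul0mx, addr0).
have DTE : D *m T = block_mx e%:M (ursubmx T) 0 0.
  rewrite DT0; move: DTDT.
  rewrite DT0 mulmx_block !(mulmx1, mulmx0, mul0mx, addr0) scale_block_mx.
  by case/eq_block_mx => ->; rewrite scalemx1.
exists (invmx L), (ursubmx T); split; first by rewrite unitmx_inv.
by rewrite -DTE XE /T !mulmxA mulVmx // mul1mx mulmxK.
Qed.

(** For e <> 0 the block B is removed by a unipotent conjugation.  For e = 0 the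
    matrix has rank r only if B has, and conjugation by a block diagonal matrix
    acts on B by independent row and column operations. *)
Lemma quadratic_normal_form (F : fieldType) r m (X : 'M[F]_(r + m)) (e : F) :
  \rank X = r -> X *m X = e *: X ->
  exists2 h, h \in unitmx &
    h *m X = block_mx e%:M (if e == 0 then pid_mx r else 0) 0 0 *m h.
Proof.
move=> rkX XX; have [h [B [uh hX]]] := quadratic_block_form rkX XX.
suff [h' uh' E] : exists2 h' : 'M_(r + m), h' \in unitmx &
    h' *m block_mx e%:M B 0 0 =
    block_mx e%:M (if e == 0 then pid_mx r else 0) 0 0 *m h'.
  by exists (h' *m h); rewrite ?unitmx_mul ?uh' // -mulmxA hX !mulmxA E.
have [e0|e0] := eqVneq e 0; last first.
  exists (block_mx 1%:M (e^-1 *: B) 0 1%:M).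
    by rewrite unitmxE det_ublock !det1 mulr1 unitr1.
  rewrite !mulmx_block !(mul1mx, mulmx1, mul0mx, mulmx0, addr0, add0r).
  by rewrite mul_scalar_mx scalerA divff // scale1r.
have rkB : \rank B = r.
  have /(congr1 (@mxrank _ _ _)) := hX.
  rewrite mxrankMfree ?row_free_unit //.
  rewrite eqmxMfull ?row_full_unit //.
  rewrite rkX e0.
  by rewrite raddf0 /block_mx row_mx0 rank_col_mx0 rank_row_0mx.
pose L := col_ebase B; pose R := row_ebase B.
have uL : L \in unitmx by exact: col_ebase_unit.
have uR : R \in unitmx by exact: row_ebase_unit.
have BE : B = L *m pid_mx r *m R by rewrite -{1}(mulmx_ebase B) rkB.
exists (block_mx (invmx L) 0 0 R).
  by rewrite block_diag_mx_unit unitmx_inv uL.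
rewrite !mulmx_block !(mul1mx, mulmx1, mul0mx, mulmx0, addr0, add0r) e0.
by rewrite raddf0 mulmx0 mul0mx {1}BE !mulmxA mulVmx // mul1mx.
Qed.

Lemma quadratic_conj (F : fieldType) n (X Y : 'M[F]_n.+1) (e : F) :
  \rank X = \rank Y -> X *m X = e *: X -> Y *m Y = e *: Y ->
  exists2 h, h \in unitmx & Y = conjm h X.
Proof.
move=> rkXY XX YY.
suff [h uh hX] : exists2 h, h \in unitmx & h *m X = Y *m h.
  by exists h => //; rewrite (conjmE uh hX).
move rY : (\rank Y) rkXY => r rX.
have le_r : (r <= n.+1)%N by rewrite -rX rank_leq_row.
have [m Em] : exists m, n.+1 = (r + m)%N by exists (n.+1 - r)%N; rewrite subnKC.
move: X Y XX YY rX rY; rewrite Em => X Y XX YY rX rY.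
have [h1 u1 E1] := quadratic_normal_form rX XX.
have [h2 u2 E2] := quadratic_normal_form rY YY.
exists (invmx h2 *m h1); first by rewrite unitmx_mul unitmx_inv u2.
by rewrite -mulmxA E1 -[Y](mulKmx u2) E2 !mulmxA mulmxK.
Qed.

(** * Elements of BwB in a quadratic class *)

(** Triangularity is with respect to the order pulled back by [phi]; this avoids
    having to sort the rows of a minor. *)
Lemma triangular_unitmx (F : fieldType) m (phi : 'I_m -> nat) (S : 'M[F]_m) :
  injective phi -> (forall s t, S s t != 0 -> (phi s <= phi t)%N) ->
  (forall s, S s s != 0) -> S \in unitmx.
Proof.
move=> inj_phi tS dS; rewrite -row_free_unit -kermx_eq0.
apply/rowV0P => u /sub_kermxP uS; apply/eqP/negPn/negP => u0.
have /existsP[t0 ut0] : [exists t, u 0 t != 0].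
  apply: contraR u0; rewrite negb_exists => /forallP u0.
  by apply/eqP/rowP => t; rewrite mxE; apply/eqP/negPn/u0.
(* in a relation u S = 0, the column of the first nonzero u_t has one term *)
case: (@arg_minnP _ t0 (fun t => u 0 t != 0) phi ut0) => t ut min_t.
have /matrixP/(_ 0 t) := uS; rewrite !mxE (bigD1 t) //= big1 ?addr0.
  by apply/eqP; rewrite mulf_neq0.
move=> s neq_st; have [->|us] := eqVneq (u 0 s) 0; first by rewrite mul0r.
have [->|/tS le_st] := eqVneq (S s t) 0; first by rewrite mulr0.
by case/eqP: neq_st; apply: inj_phi; apply/eqP; rewrite eqn_leq le_st min_t.
Qed.

Lemma mxsub_rank (F : fieldType) m n p q (f : 'I_p -> 'I_m) (h : 'I_q -> 'I_n)
  (A : 'M[F]_(m, n)) : (\rank (mxsub f h A) <= \rank A)%N.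
Proof.
have -> : mxsub f h A = rowsub f 1%:M *m A *m colsub h 1%:M.
  by rewrite mul_rowsub_mx mul1mx -mxsub_mul mulmx1.
exact: leq_trans (mxrankM_maxl _ _) (mxrankM_maxr _ _).
Qed.

(** Conjugation by the right factor moves it to the left. *)
Lemma bruhat_conj_borel (k : fieldType) n (w : 'S_n.+1) (g : 'M[k]_n.+1) :
  bruhat_cell w g -> exists b M h,
    [/\ borel b, weyl_rep w M, SL h & conjm h g = b *m M].
Proof.
move=> [b1 [M [b2 [B1 WM B2 ->]]]]; exists (b2 *m b1), M, b2.
have [S2 _] := B2; have u2 := SL_unitmx S2.
by split => //; [exact: borelM | apply: conjmE => //; rewrite !mulmxA].
Qed.

Lemma expg2P (T : finType) (w : {perm T}) :
  reflect (forall x, w (w x) = x) (w ^+ 2 == 1)%g.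
Proof.
apply: (iffP eqP) => [w2 x|w2]; first by rewrite -permM -expg2 w2 perm1.
by apply/permP => x; rewrite expg2 permM w2 perm1.
Qed.

Lemma perm_le_id n (s : 'S_n) : (forall i, s i <= i)%N -> s = 1%g.
Proof.
move=> le_s; apply/permP => i; rewrite perm1.
have [m le_im] : exists m, (i < m)%N by exists i.+1.
elim: m i le_im => // m IHm i; rewrite ltnS leq_eqVlt => /predU1P[Ei|/IHm//].
apply/val_inj/eqP; rewrite eqn_leq le_s leqNgt /=; apply/negP => lt_s.
have := IHm (s i); rewrite -Ei => /(_ lt_s) /perm_inj E.
by rewrite E ltnn in lt_s.
Qed.

Lemma mulmx_weyl_rep (k : fieldType) n (A M : 'M[k]_n.+1) (w : 'S_n.+1) i j :
  weyl_rep w M -> (A *m M) i j = A i (w j) * M (w j) j.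
Proof.
move=> [_ WM]; rewrite mxE (bigD1 (w j)) //= big1 ?addr0 // => l lw.
by have := WM l j; rewrite (negPf lw) => /negbFE/eqP ->; rewrite mulr0.
Qed.

(** The inverse M^-1 b^-1 of g = b M is a multiple of s - g, hence off the
    diagonal a multiple of g.  If w y <> y, the entry of g in place (w y, y) is
    off the diagonal and nonzero, whereas that of M^-1 b^-1 is a multiple of
    the entry (w (w y), y) of b^-1, which vanishes unless w (w y) <= y. *)
Lemma quadratic_borel_involution (k : fieldType) n (b M : 'M[k]_n.+1)
    (w : 'S_n.+1) (s d : k) : borel b -> weyl_rep w M -> d != 0 ->
  (b *m M) *m (b *m M) = s *: (b *m M) - d%:M -> (w ^+ 2 = 1)%g.
Proof.
move=> Bb [SM WM] d0 gg; have [tb db] := borelP Bb.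
have [ub uM] : b \in unitmx /\ M \in unitmx.
  by split; apply: SL_unitmx => //; case: Bb.
have gE x y := mulmx_weyl_rep b x y (conj SM WM).
have inv : M *m (s%:M - b *m M) = d *: invmx b.
  apply: (can_inj (mulKmx ub)).
  rewrite -scalemxAr mulmxV // mulmxA mulmxBr gg mul_mx_scalar.
  by rewrite opprB addrC addrNK scalemx1.
have tib := invmx_borel Bb.
apply: perm_le_id => y; rewrite expgS expg1 permM leqNgt; apply/negP => lt_y.
have neq : w y != y by apply: contraTneq lt_y => E; rewrite !E ltnn.
have /matrixP/(_ (w (w y)) y) := inv.
rewrite [RHS]mxE tib // mulr0 mxE (bigD1 (w y)) //= big1 ?addr0; last first.
  move=> l lw; have := WM (w (w y)) l; rewrite (inj_eq perm_inj) [w y == l]eq_sym.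
  by rewrite (negPf lw) => /negbFE/eqP ->; rewrite mul0r.
rewrite mxE [s%:M _ _]mxE (negPf neq) mxE gE add0r => /eqP; apply/negP.
by rewrite mulrN oppr_eq0 !mulf_neq0 ?WM.
Qed.

(** Row w i and column j of the minor can coincide, for i and j in E, only if
    both j < w j = i and i < w i = j.  So the minor does not involve c, and it
    equals the principal minor of b on w(E) up to a scaling of its columns. *)
Lemma l2_le_rank (k : fieldType) n (b M : 'M[k]_n.+1) (w : 'S_n.+1) (c : k) :
  borel b -> weyl_rep w M -> (w ^+ 2 = 1)%g ->
  (l2 w <= \rank (b *m M - c%:M)%R)%N.
Proof.
move=> Bb [SM WM] /eqP/expg2P w2; have [tb db] := borelP Bb.
have gE x y := mulmx_weyl_rep b x y (conj SM WM).
pose E := [pred i : 'I_n.+1 | (i < w i)%N].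
pose f (t : 'I_(l2 w)) : 'I_n.+1 := @enum_val _ E t.
have fE t : (f t < w (f t))%N by have := @enum_valP _ E t.
apply: leq_trans (mxsub_rank (w \o f) f _).
suff uS : mxsub (w \o f) f (b *m M - c%:M) \in unitmx by rewrite mxrank_unit.
have SE t t' : mxsub (w \o f) f (b *m M - c%:M) t t' =
    b (w (f t)) (w (f t')) * M (w (f t')) (f t').
  rewrite mxE mxE gE [X in _ + X]mxE [c%:M _ _]mxE /=.
  case: eqP => [E1|_]; last by rewrite subr0.
  by have := fE t'; rewrite -E1 w2 ltnNge ltnW.
apply: (@triangular_unitmx _ _ (fun t => w (f t))).
- by move=> t t' /val_inj/perm_inj; apply: enum_val_inj.
- move=> t t'; rewrite SE; apply: contraR; rewrite -ltnNge => lt.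
  by rewrite tb ?mul0r.
- by move=> t; rewrite SE mulf_neq0 ?WM.
Qed.

(** * Extending an involution *)

(** [w] exchanges the points it moves up and those it moves down, so it has
    N - 2 l_2(w) fixed points. *)
Lemma involution_two_fixed n (w : 'S_n.+1) : (w ^+ 2 = 1)%g ->
  ((l2 w).+1.*2 <= n.+1)%N -> exists i j : 'I_n.+1, [/\ (i < j)%N, w i = i & w j = j].
Proof.
move=> /eqP/expg2P w2 lt_l.
pose A := [set x : 'I_n.+1 | (x < w x)%N]%SET.
pose F := [set x : 'I_n.+1 | w x == x]%SET.
have cardA : #|A| = l2 w by rewrite cardsE.
have cover : [set: 'I_n.+1]%SET \subset (A :|: [set w x | x in A] :|: F)%SET.
  apply/fintype.subsetP => x _; rewrite !inE.
  case: (ltngtP x (w x)) => //= [lt|/val_inj <-]; last by rewrite eqxx orbT.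
  by rewrite (_ : x \in _) //; apply/imsetP; exists (w x); rewrite ?inE w2.
have := subset_leq_card cover; rewrite cardsT card_ord => le_n.
have {le_n} := leq_trans le_n (leq_card_setU _ _).
move=> /leq_trans/(_ (leq_add (leq_card_setU _ _) (leqnn _))).
rewrite card_imset; last exact: perm_inj.
rewrite cardA addnn => le_n.
have /card_gt1P[i [j [Fi Fj neq_ij]]] : (1 < #|F|)%N.
  rewrite -(leq_add2l (l2 w).*2) (leq_trans _ le_n) // (leq_trans _ lt_l) //.
  by rewrite doubleS addn2.
move: Fi Fj; rewrite !inE => /eqP Fi /eqP Fj.
have [lt|lt|/val_inj E] := ltngtP i j; [by exists i, j|by exists j, i|].
by rewrite E eqxx in neq_ij.
Qed.

Lemma involution_extend n r (w : 'S_n.+1) : (w ^+ 2 = 1)%g ->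
  (l2 w <= r)%N -> (r.*2 <= n.+1)%N ->
  exists w' : 'S_n.+1,
    [/\ (w' ^+ 2 = 1)%g, l2 w' = r & forall x, w x != x -> w' x = w x].
Proof.
move=> w2 le_r le_n; have [m Er] : exists m, (r = l2 w + m)%N.
  by exists (r - l2 w)%N; rewrite subnKC.
elim: m w w2 {le_r} Er => [|m IHm] w w2 Er.
  by exists w; split => //; rewrite Er addn0.
have [|i [j [lt_ij wi wj]]] := involution_two_fixed w2.
  by rewrite (leq_trans _ le_n) // leq_double Er addnS ltnS leq_addr.
have neq_ij : i != j by rewrite -val_eqE neq_ltn lt_ij.
pose w1 := (tperm i j * w)%g.
have w1i : w1 i = j by rewrite permM tpermL.
have w1j : w1 j = i by rewrite permM tpermR.
have w1D x : x != i -> x != j -> w1 x = w x.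
  by move=> xi xj; rewrite permM tpermD // eq_sym.
have /eqP/expg2P wK := w2.
have w12 : (w1 ^+ 2 = 1)%g.
  apply/eqP/expg2P => x; have [->|xi] := eqVneq x i; first by rewrite w1i.
  have [->|xj] := eqVneq x j; first by rewrite w1j.
  rewrite (w1D x) // w1D ?wK //.
    by rewrite -wi (inj_eq perm_inj).
  by rewrite -wj (inj_eq perm_inj).
have l2w1 : l2 w1 = (l2 w).+1.
  rewrite /l2 (cardD1 i) inE w1i lt_ij add1n; congr _.+1.
  apply: eq_card => x; rewrite !inE.
  have [->|xi] := eqVneq x i; first by rewrite wi ltnn.
  have [->|xj] := eqVneq x j; last by rewrite w1D.
  by rewrite w1j wj ltnn ltnNge ltnW.
have [|w' [w'2 l2w' ext]] := IHm w1 w12; first by rewrite l2w1 addSn -addnS.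
exists w'; split => // x wx.
have xi : x != i by apply: contraNneq wx => ->; rewrite wi.
have xj : x != j by apply: contraNneq wx => ->; rewrite wj.
by rewrite ext w1D.
Qed.

(** * A representative of the class in BwB *)

(** Undoing the row permutation [w] makes g upper triangular; its diagonal is
    absorbed into the monomial matrix, so that the factor in B is unipotent. *)
Lemma bruhat_cellP (k : fieldType) n (w : 'S_n.+1) (g : 'M[k]_n.+1) :
  SL g -> (forall y x : 'I_n.+1, (x < y)%N -> g (w y) x = 0) ->
  (forall y, g (w y) y != 0) -> bruhat_cell w g.
Proof.
move=> Sg tg dg.
pose M := \matrix_(i, j) (if i == w j then g i j else 0) : 'M[k]_n.+1.
pose b := \matrix_(i, j) ((g (w i) i)^-1 * g (w i) j) : 'M[k]_n.+1.
have gE : g = M *m b.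
  apply/matrixP => i j; rewrite mxE (bigD1 (w^-1 i)%g) //= !mxE permKV eqxx.
  rewrite big1 ?addr0 => [|l li].
    by rewrite mulrA divff ?mul1r //; have := dg (w^-1 i)%g; rewrite permKV.
  rewrite !mxE ifF ?mul0r //; apply: contraNF li => /eqP ->.
  by rewrite permK.
have tb : is_trig_mx b^T.
  by apply/is_trig_mxP => j i lt_ji; rewrite !mxE (tg i j) ?mulr0.
have db : \det b = 1.
  rewrite -det_tr det_trig //; apply: big1 => i _; rewrite !mxE mulVf //.
have SM : SL M by move: Sg; rewrite /SL /= gE det_mulmx db mulr1.
exists 1%:M, M, b; split; last by rewrite mul1mx.
- by split; rewrite ?trmx1 ?scalar_mx_is_trig // /SL /= det1.
- split=> // i j; rewrite mxE; have [->|] := eqVneq i (w j); first by rewrite dg.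
  by rewrite eqxx.
- by split.
Qed.

Lemma sum_indic (R : nzRingType) (I : finType) (h : I -> R) c :
  \sum_x (x == c)%:R * h x = h c.
Proof.
rewrite (bigD1 c) //= eqxx mul1r big1 ?addr0 // => x /negPf ->.
by rewrite mul0r.
Qed.

(** X is a sum of r products u_t v_t, one for each transposition (f t, p t) of an
    extension w' of w, with u_t and v_t supported on {f t, p t} and v_t u_t = b - a.
    Hence X = U V with V U = (b - a) I_r, which gives the quadratic equation.
    If (f t, p t) is a transposition of w, then u_t = (-a, 1) and v_t = (1, b), so
    that a + X has the block [0, -ab; 1, a + b]; otherwise u_t = (1, b - a) and
    v_t = (0, 1), with block [a, 1; 0, b].  The nonzero off-diagonal entry makes
    the construction valid also when a = b. *)
Lemma involution_model (k : fieldType) n r (a b : k) (w : 'S_n.+1) :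
  a != 0 -> b != 0 -> (w ^+ 2 = 1)%g -> (l2 w <= r)%N -> (r.*2 <= n.+1)%N ->
  exists X : 'M[k]_n.+1, [/\ \rank X = r, X *m X = (b - a) *: X,
    (forall y x : 'I_n.+1, (x < y)%N -> (a%:M + X) (w y) x = 0)
    & forall y, (a%:M + X) (w y) y != 0].
Proof.
move=> a0 b0 w2 le_r le_n.
have [w' [/eqP/expg2P w'K l2w' ext]] := involution_extend w2 le_r le_n.
case: r / l2w' le_r le_n => _ _.
move/eqP/expg2P: w2 => wK.
pose E := [pred i : 'I_n.+1 | (i < w' i)%N].
pose f (t : 'I_(l2 w')) : 'I_n.+1 := @enum_val _ E t.
pose p t := w' (f t).
have fp t : (f t < p t)%N by have := @enum_valP _ E t.
have f_inj : injective f by apply: enum_val_inj.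
have ff s t : (f s == f t) = (s == t) by rewrite (inj_eq f_inj).
have pp s t : (p s == p t) = (s == t) by rewrite (inj_eq perm_inj) ff.
have fps s t : (f s == p t) = false.
  apply/negP => /eqP Es; have := fp s.
  by rewrite /p Es w'K ltnNge ltnW.
have pfs s t : (p s == f t) = false by rewrite eq_sym.
pose m t := w (f t) != f t.
have wf t : w (f t) = if m t then p t else f t.
  by case: ifP => [/ext <- //|/negbFE/eqP].
have wp t : w (p t) = if m t then f t else p t.
  case: ifP => [mt|/negP mt]; first by rewrite -(wK (f t)) wf mt.
  apply/eqP/negPn/negP => wpt; apply: mt.
  have E1 : f t = w (p t) by rewrite -ext // /p w'K.
  by apply/negP; rewrite E1 wK eq_sym.
pose e := b - a.
pose u t x : k := if m t then (x == p t)%:R - a * (x == f t)%:R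
  else (x == f t)%:R + e * (x == p t)%:R.
pose v t x : k := if m t then (x == f t)%:R + b * (x == p t)%:R
  else (x == p t)%:R.
pose U := \matrix_(x, t) u t x; pose V := \matrix_(t, x) v t x.
have vsum t h : \sum_x v t x * h x = if m t then h (f t) + b * h (p t) else h (p t).
  rewrite /v; case: (m t); last exact: sum_indic.
  under eq_bigr do rewrite mulrDl -mulrA.
  by rewrite big_split /= -mulr_sumr !sum_indic.
have VU : V *m U = e%:M.
  apply/matrixP => s t; rewrite !mxE.
  under eq_bigr do rewrite !mxE.
  rewrite vsum /u ff pp fps pfs; have [->|_] := eqVneq s t.
    by case: (m t) => /=; rewrite /e; ring.
  by case: (m s); case: (m t) => /=; ring.
(* one-sided inverses of U and V, which show that U V has full rank r *)
pose L := \matrix_(t, x) (x == if m t then p t else f t)%:R : 'M[k]_(_, n.+1).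
pose R := \matrix_(x, t) (x == if m t then f t else p t)%:R : 'M[k]_(n.+1, _).
have LU : L *m U = 1%:M.
  apply/matrixP => s t; rewrite !mxE.
  under eq_bigr do rewrite !mxE.
  rewrite sum_indic /u; have [->|st] := eqVneq s t.
    by case: (m t); rewrite ?ff ?pp ?fps ?pfs eqxx /=; ring.
  by case: (m s); case: (m t); rewrite ?ff ?pp ?fps ?pfs ?(negPf st) /=; ring.
have VR : V *m R = 1%:M.
  apply/matrixP => s t; rewrite !mxE.
  under eq_bigr do rewrite !mxE.
  rewrite vsum; have [->|st] := eqVneq s t.
    by case: (m t); rewrite ?ff ?pp ?fps ?pfs eqxx /=; ring.
  by case: (m s); case: (m t); rewrite ?ff ?pp ?fps ?pfs ?(negPf st) /=; ring.
exists (U *m V).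
have UVf s y : (U *m V) (f s) y = (if m s then - a else 1) * v s y.
  rewrite mxE -(sum_indic (fun t => (if m t then - a else 1) * v t y)).
  apply: eq_bigr => t _; rewrite !mxE mulrA; congr (_ * _).
  by rewrite /u ff fps eq_sym; case: (m t) => /=; ring.
have UVp s y : (U *m V) (p s) y = (if m s then 1 else e) * v s y.
  rewrite mxE -(sum_indic (fun t => (if m t then 1 else e) * v t y)).
  apply: eq_bigr => t _; rewrite !mxE mulrA; congr (_ * _).
  by rewrite /u pp pfs eq_sym; case: (m t) => /=; ring.
have split3 (P : 'I_n.+1 -> Prop) : (forall s, P (f s)) -> (forall s, P (p s)) ->
    (forall y, (forall s, y != f s) -> (forall s, y != p s) -> P y) ->
    forall y, P y.
  move=> Pf Pp P0 y.
  have [/existsP[s /eqP->]//|nf] := boolP [exists s, y == f s].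
  have [/existsP[s /eqP->]//|np] := boolP [exists s, y == p s].
  apply: P0 => s; [apply: contraNneq nf | apply: contraNneq np] => ->;
    by apply/existsP; exists s.
have UV0 y x : (forall s, y != f s) -> (forall s, y != p s) -> (U *m V) y x = 0.
  move=> yf yp; rewrite mxE big1 // => t _; rewrite !mxE /u.
  by rewrite (negPf (yf t)) (negPf (yp t)); case: (m t) => /=; ring.
have fsurj (x : 'I_n.+1) : (x < w' x)%N -> exists s, x = f s.
  by move=> Ex; exists (@enum_rank_in _ x E Ex x); rewrite /f enum_rankK_in.
have wfix y : (forall s, y != f s) -> (forall s, y != p s) -> w y = y.
  move=> yf yp; apply/eqP/negPn/negP => wy; have w'y := ext y wy.
  case: (ltngtP y (w y)) => [lt|lt|/val_inj E1].
  - by have [|s ys] := fsurj y; rewrite ?w'y //; have := yf s; rewrite ys eqxx.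
  - have [|s ys] := fsurj (w y); first by rewrite -w'y w'K w'y.
    by have := yp s; rewrite /p -ys -w'y w'K eqxx.
  - by rewrite -E1 eqxx in wy.
split.
- apply/eqP; rewrite eqn_leq mulmx_max_rank (@mulmx1_min_rank _ _ _ _ _ L R) //.
  by rewrite mulmxA LU mul1mx.
- by rewrite mulmxA -(mulmxA U) VU mul_mx_scalar scalemxAl.
- elim/split3 => [s|s|y yf yp] x lt_xy; rewrite mxE [a%:M _ _]mxE.
  + have xf : (x == f s) = false by rewrite -val_eqE ltn_eqF.
    have xp : (x == p s) = false by rewrite -val_eqE ltn_eqF ?(ltn_trans lt_xy).
    rewrite wf; case ms: (m s); rewrite ?UVp ?UVf ms /v ms ![_ == x]eq_sym xf xp /=;
      by ring.
  + have xp : (x == p s) = false by rewrite -val_eqE ltn_eqF.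
    rewrite wp; case ms: (m s); rewrite ?UVp ?UVf ms /v ms ![_ == x]eq_sym xp /=.
      by case: (x == f s) => /=; ring.
    by ring.
  + rewrite UV0 ?wfix // addr0 [y == x]eq_sym.
    by rewrite -val_eqE ltn_eqF.
- elim/split3 => [s|s|y yf yp]; rewrite mxE [a%:M _ _]mxE.
  + rewrite wf; case ms: (m s); rewrite ?UVp ?UVf ms /v ms ?pfs ?fps eqxx /=.
      by rewrite mul1r mulr0 addr0 add0r oner_neq0.
    by rewrite mulr0 addr0.
  + rewrite wp; case ms: (m s); rewrite ?UVp ?UVf ms /v ms ?pfs ?fps eqxx /=.
      by rewrite !add0r mulr1 mulNr oppr_eq0 mulf_neq0 // b0.
    by rewrite mulr1 /e addrC subrK b0.
  + by rewrite UV0 ?wfix // addr0 eqxx.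
Qed.

(** * The minimal rank *)

Lemma min_rankP (k : fieldType) n (g : 'M[k]_n.+1) :
  (exists c, \rank (g - c%:M)%R = min_rank g) /\
  forall c, (min_rank g <= \rank (g - c%:M)%R)%N.
Proof.
rewrite /min_rank; case: ex_minnP => m /asboolP mP min_m; split=> // c.
by apply: min_m; apply/asboolP; exists c.
Qed.

Lemma factor_quadratic (k : fieldType) n (g : 'M[k]_n.+1) s d c :
  g *m g = s *: g - d%:M ->
  (g - c%:M) *m (g - (s - c)%:M) = (c * (s - c) - d)%:M.
Proof.
move=> gg; rewrite mulmxBl !mulmxBr gg mul_mx_scalar !mul_scalar_mx.
rewrite scale_scalar_mx [RHS]raddfB /= scalerBl.
set A := s *: g; set B := c *: g; set K := (_)%:M; set K' := (_)%:M.
by rewrite !opprB [A - K]addrC -[_ + A + _]addrA subrKC -addrA subrKC addrC.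
Qed.

(** If c is not a root of X^2 - s X + d then g - c is invertible.  If the minimal
    rank were reached at such a c, all g - x would be invertible, contradicting
    (g - a) (g - (s - a)) = 0 for a root a. *)
Lemma min_rank_eigen (k : closedFieldType) n (g : 'M[k]_n.+1) s d :
  g *m g = s *: g - d%:M ->
  exists a, \rank (g - a%:M)%R = min_rank g /\ a * (s - a) = d.
Proof.
move=> gg; have [[c rc] min_c] := min_rankP g.
have [E|nE] := eqVneq (c * (s - c)) d; first by exists c.
have [a] := @GRing.solve_monicpoly k 2 (fun i => if i == 0%N then - d else s) isT.
rewrite !big_ord_recl big_ord0 /= mulr1 expr1 addr0 => aE.
have {}aE : a * (s - a) = d.
  by rewrite mulrBr -expr2 aE (mulrC s); ring.
have rkc : \rank (g - c%:M)%R = n.+1.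
  have := factor_quadratic c gg => E.
  apply: mxrank_unit.
  have : (c * (s - c) - d)%:M \in @unitmx k n.+1.
    by rewrite unitmxE det_scalar unitrX // unitfE subr_eq0.
  by rewrite -E unitmx_mul => /andP[].
have full x : (g - x%:M) \in unitmx.
  rewrite -row_free_unit -row_leq_rank -{1}rkc rc min_c //.
have := factor_quadratic a gg; rewrite aE subrr raddf0 => E0.
have := unitmx_mul (g - a%:M) (g - (s - a)%:M).
by rewrite E0 !full unitmxE det0 unitr0.
Qed.

Lemma sub_quadratic (k : fieldType) n (g : 'M[k]_n.+1) s d a :
  g *m g = s *: g - d%:M -> a * (s - a) = d ->
  (g - a%:M) *m (g - a%:M) = (s - a - a) *: (g - a%:M).
Proof.
move=> gg ad; have := factor_quadratic a gg; rewrite ad subrr raddf0 => E0.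
have E : g - a%:M = (g - (s - a)%:M) + (s - a - a)%:M.
  by rewrite [(s - a - a)%:M]raddfB /= addrA subrK.
by rewrite {2}E mulmxDr E0 add0r mul_mx_scalar.
Qed.

Theorem corollary4p6 (k : closedFieldType) (n : nat) (hn : (1 <= n)%N)
    (hk : 2%N \notin [pchar k]) (C : set 'M[k]_n.+1)
    (hC : SL_class C) (hS : spherical C) (g : 'M[k]_n.+1) (hg : C g) :
  W_ C = [set w : 'S_n.+1 | (w ^+ 2 = 1)%g /\ (l2 w <= min_rank g)%N].
Proof.
apply/seteqP; split => w /=.
- move=> [x [Cx /bruhat_conj_borel[b [M [h [Bb WM Sh hx]]]]]].
  have uh := SL_unitmx Sh.
  have CbM : C (b *m M) by rewrite -hx; apply: SL_class_conj_GL.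
  have [s [d [d0 gg]]] := spherical_quadratic hn hC hS CbM.
  have w2 := quadratic_borel_involution Bb WM d0 gg.
  split=> //; have [h' Sh' gE] := SL_class_orbit hC hg CbM.
  have [[c <-] _] := min_rankP g.
  rewrite -(mxrank_conjm (g - c%:M) (SL_unitmx Sh')) conjmB.
  by rewrite conjm_scalar ?SL_unitmx // -gE l2_le_rank.
- move=> [w2 le_w].
  have [s [d [d0 gg]]] := spherical_quadratic hn hC hS hg.
  have [a [ra ad]] := min_rank_eigen gg.
  have XX := sub_quadratic gg ad.
  move: d0; rewrite -ad mulf_eq0 => /norP[a0 b0].
  (* (g - a) (g - b) = 0 and both factors have at least the minimal rank *)
  have le_n : ((min_rank g).*2 <= n.+1)%N.
    have := factor_quadratic a gg; rewrite ad subrr raddf0.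
    move/mulmx0_rank_max; apply: leq_trans.
    by rewrite ra -addnn leq_add2l; have [_ ->] := min_rankP g.
  have [X [rX X2 tX dX]] := involution_model a0 b0 w2 le_w le_n.
  have [|h uh XE] := quadratic_conj _ XX X2; first by rewrite rX.
  have gE : conjm h g = a%:M + X.
    by rewrite XE conjmB conjm_scalar // addrC subrK.
  have CX : C (a%:M + X) by rewrite -gE; apply: SL_class_conj_GL.
  exists (a%:M + X); split => //.
  by apply: bruhat_cellP => //; apply: SL_class_SL CX.
Qed.
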